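(* If a space $X$ has the property $S_1^*(\mathcal{G}_K,\mathcal{G})$, then $X$ satisfies $U_{fin}^*(\mathcal{O}_\cup,\Omega)$.
   Context: For $A\subseteq X$ and a collection $\mathcal{P}$ of subsets of $X$, $St(A,\mathcal{P})=\bigcup\{B\in\mathcal{P} : A\cap B\neq\emptyset\}$. Families of covers of $X$: - $\mathcal{G}$: all covers $\mathcal{U}$ of $X$ each element of which is a $G_\delta$ set. - $\mathcal{G}_K$ (Alster covers): all $\mathcal{U}\in\mathcal{G}$ such that $X\notin\mathcal{U}$ and for each compact $C\subseteq X$ there is a $U\in\mathcal{U}$ with $C\subseteq U$. - $\mathcal{O}_\cup$: all open covers of $X$ that are closed under finite unions. - $\Omega$ ($\omega$-covers): all open covers $\mathcal{U}$ of $X$ such that $X\notin\mathcal{U}$ and each finite $F\subseteq X$ is contained in some member of $\mathcal{U}$. Selection principles, for collections $\mathcal{A},\mathcal{B}$ of covers of $X$: - $S_1^*(\mathcal{A},\mathcal{B})$: for each sequence $(\mathcal{U}_n)_{n\in\mathbb{N}}$ of elements of $\mathcal{A}$ there are $V_n\in\mathcal{U}_n$ such that $\{St(V_n,\mathcal{U}_n) : n\in\mathbb{N}\}\in\mathcal{B}$. - $U_{fin}^*(\mathcal{A},\mathcal{B})$: for each sequence $(\mathcal{U}_n)_{n\in\mathbb{N}}$ of elements of $\mathcal{A}$ there are finite $\mathcal{V}_n\subseteq\mathcal{U}_n$ such that $\{St(\bigcup\mathcal{V}_n,\mathcal{U}_n) : n\in\mathbb{N}\}\in\mathcal{B}$,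 or there is some $n$ such that $St(\bigcup\mathcal{V}_n,\mathcal{U}_n)=X$. *)

(* Defs.v *)
From mathcomp Require Import all_boot.
From mathcomp Require Import boolp classical_sets functions cardinality.
From mathcomp Require Import topology borel_hierarchy.

Set Implicit Arguments.
Unset Strict Implicit.
Unset Printing Implicit Defensive.

Local Open Scope classical_set_scope.

Section Stars.
Variable X : Type.
Implicit Types (A : set X) (P : set (set X)).

Definition is_cover P := \bigcup_(B in P) B = [set: X].

Definition star A P : set X :=
  \bigcup_(B in [set B | P B /\ A `&` B !=set0]) B.

                                                                       
                                     
Definition closed_finite_unions P :=
  forall V : set (set X), finite_set V -> V !=set0 -> V `<=` P ->
    P (\bigcup_(B in V) B).

End Stars.

Section SelectionPrinciples.
Variable X : Type.
Variables (A B : set (set (set X))).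

Definition star_S1 :=
  forall U : nat -> set (set X), (forall n, A (U n)) ->
    exists V : nat -> set X,
      (forall n, U n (V n)) /\ B (range (fun n => star (V n) (U n))).

Definition star_Ufin :=
  forall U : nat -> set (set X), (forall n, A (U n)) ->
    exists V : nat -> set (set X),
      (forall n, finite_set (V n) /\ V n `<=` U n) /\
      (B (range (fun n => star (\bigcup_(C in V n) C) (U n))) \/
       exists n, star (\bigcup_(C in V n) C) (U n) = [set: X]).

End SelectionPrinciples.

Section CoverFamilies.
Variable X : topologicalType.

Definition open_covers : set (set (set X)) :=
  [set U | is_cover U /\ forall B, U B -> open B].

Definition Gdelta_covers : set (set (set X)) :=
  [set U | is_cover U /\ forall B, U B -> Gdelta B].

Definition Alster_covers : set (set (set X)) :=
  [set U | [/\ Gdelta_covers U, ~ U [set: X] &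
    forall C : set X, compact C -> exists2 B, U B & C `<=` B]].

Definition open_covers_cup : set (set (set X)) :=
  [set U | open_covers U /\ closed_finite_unions U].

Definition omega_covers : set (set (set X)) :=
  [set U | [/\ open_covers U, ~ U [set: X] &
    forall F : set X, finite_set F -> exists2 B, U B & F `<=` B]].

End CoverFamilies.

(* Main.v *)
Require Import Defs.
From mathcomp Require Import all_boot.
From mathcomp Require Import boolp classical_sets functions cardinality.
From mathcomp Require Import topology borel_hierarchy.

(** For open covers U_n closed under finite unions, let W consist of all
    intersections of one member from each U_n.  It is an Alster cover, since
    every compact set lies in a single member of each U_n.  Selecting from the
    constant sequence W yields sets W_m, the intersection over n of some A_{m,n}
    in U_n, whose stars in W cover X.  A point of St(W_m, W) lies in
    St(A_{m,n}, U_n) for every n, so the families {A_{m,n} : m <= n} work: the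
    star of their union contains a given point for all large n. *)

Set Implicit Arguments.
Unset Strict Implicit.
Unset Printing Implicit Defensive.

Local Open Scope classical_set_scope.

(** Directedness makes the tails [[set B | U B /\ A]<=[B]] a filter base on [U]. Near-covering
    compactness along this filter gives a tail all of whose members contain [C], among them its
    least member [A]. *)
Lemma compact_directed_cover (X : topologicalType) (U : set (set X)) (C : set X) :
  U !=set0 -> open_covers U ->
  (forall A B, U A -> U B -> exists2 D, U D & A `|` B `<=` D) ->
  compact C -> exists2 B, U B & C `<=` B.
Proof.
move=> [A0 UA0] [covU opU] dirU /compact_near_coveringP covC.
pose F := filter_from U (fun A => [set B | U B /\ A `<=` B]).
have FF : Filter F.
  apply: filter_from_filter; first by exists A0.
  move=> A B UA UB; have [D UD ABD] := dirU A B UA UB.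
  exists D => // E [UE DE]; split; split=> //.
    by move=> x Ax; apply: DE; apply: ABD; left.
  by move=> x Bx; apply: DE; apply: ABD; right.
have [|A UA AP] := covC _ F (fun B x => U B /\ B x).
  move=> x _; have [A UA Ax] : (\bigcup_(B in U) B) x by rewrite covU.
  exists (A, [set B | U B /\ A `<=` B]); last first.
    by move=> [y B] /= [Ay [UB AB]]; split=> //; exact: AB.
  by split=> /=; [exact: open_nbhs_nbhs (conj (opU _ UA) Ax)|exists A].
exists A => // x Cx.
by have [] := AP A (conj UA (@subset_refl _ A)) x Cx.
Qed.

Lemma closed_finite_unionsU (X : Type) (U : set (set X)) (A B : set X) :
  closed_finite_unions U -> U A -> U B -> U (A `|` B).
Proof.
move=> UU UA UB.
rewrite -(bigcup_set1 id A) -(bigcup_set1 id B) -bigcup_setU.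
by apply: UU => [||_ [->|->]] //; exists A; left.
Qed.

Lemma star_open (X : topologicalType) (A : set X) (U : set (set X)) :
  (forall B, U B -> open B) -> open (star A U).
Proof. by move=> opU; apply: bigcup_open => B [/opU]. Qed.

(** The finitely many points of [F] have finitely many thresholds; their maximum works. *)
Lemma eventually_finite_cover (X : Type) (T : nat -> set X) (F : set X) :
  finite_set F ->
  (forall x, exists m, forall n, m <= n -> T n x) -> exists n, F `<=` T n.
Proof.
move=> finF /choice[m mT].
have /finite_seqP[s ms] := finite_image m finF.
exists (\max_(i <- s) i) => x Fx; apply: mT.
have : (m @` F) (m x) by exists x.
by rewrite ms /= => /leq_bigmax_seq ->.
Qed.

Section Selection.
Variables (X : topologicalType) (U : nat -> set (set X)).

Definition selections : set (set X) :=
  [set W | exists2 A : nat -> set X, (forall n, U n (A n)) &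
           W = \bigcap_n A n].

Lemma selections_Alster : [set: X] !=set0 ->
  (forall n, open_covers_cup (U n)) -> ~ (exists n, U n [set: X]) ->
  Alster_covers selections.
Proof.
move=> [x0 _] coverU noX.
have cptW C : compact C -> exists2 B, selections B & C `<=` B.
  move=> cptC.
  have /choice[A AP] n : exists A, U n A /\ C `<=` A.
    have [oU cU] := coverU n.
    have [||||A UA CA] := @compact_directed_cover X (U n) C; last by exists A.
    (* [C] may be empty, so a member of [U n] comes from the point [x0]. *)
    - have [A UA _] : (\bigcup_(B in U n) B) x0 by rewrite oU.1.
      by exists A.
    - exact: oU.
    - by move=> A B UA UB; exists (A `|` B) => //; exact: closed_finite_unionsU.
    - exact: cptC.
  exists (\bigcap_n A n); first by exists A => // n; exact: (AP n).1.
  by move=> x Cx n _; exact: (AP n).2.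
split=> //.
- split.
    rewrite /is_cover -subTset => x _.
    have [B WB xB] := cptW [set x] (@compact_set1 X x).
    by exists B => //; exact: xB.
  by move=> _ [A UA ->]; exists A => // n; have [[_ opU] _] := coverU n; exact: opU.
(* An intersection equal to the whole space forces its factor [A 0] to be the whole space. *)
- move=> [A UA AT]; apply: noX; exists 0; rewrite (_ : setT = A 0) //.
  by apply/seteqP; split=> // x; rewrite AT; apply.
Qed.

End Selection.

Theorem theorem3p28 (X : topologicalType) :
  star_S1 (@Alster_covers X) (@Gdelta_covers X) ->
  star_Ufin (@open_covers_cup X) (@omega_covers X).
Proof.
move=> S1 U coverU.
have [[x0 _]|X0] := pselect ([set: X] !=set0); last first.
  exists (fun=> set0); split; first by move=> n; split.
  by right; exists 0; apply/seteqP; split=> // x _; case: X0; exists x.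
have [[n UnX]|noX] := pselect (exists n, U n [set: X]).
  (* This family is the singleton of [[set: X]] at index [n] and empty elsewhere; as [X] has a
     point, the star at [n] is everything. *)
  exists (fun k => [set B | k = n /\ B = [set: X]]); split.
    move=> k; split; last by move=> B [-> ->].
    by apply: (@sub_finite_set _ _ [set setT]) => // B [].
  right; exists n; rewrite -subTset => x _; exists setT => //.
  by split=> //; exists x; split=> //; exists setT.
have altW := selections_Alster (ex_intro _ x0 I) coverU noX.
have [W [selW [covW _]]] := S1 (fun=> selections U) (fun=> altW).
have /choice[A AP] m : exists A : nat -> set X,
    (forall n, U n (A n)) /\ W m = \bigcap_n A n.
  by have [A] := selW m; exists A.
pose V n : set (set X) := (fun m => A m n) @` [set m | m <= n].
pose T n := star (\bigcup_(C in V n) C) (U n).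
exists V; split.
  move=> n; split; last by move=> _ [m _ <-]; exact: (AP m).1.
  by apply: finite_image; apply: (@sub_finite_set _ _ `I_n.+1).
(* An omega-cover must not contain [X]; a star equal to [X] falls under the second alternative. *)
have [TX|TX] := pselect (exists n, T n = [set: X]); [by right|left].
have evT x : exists m, forall n, m <= n -> T n x.
  (* Some intersection of sets [B n] contains [x] and meets [W m] at [y]. For [n] at least [m],
     [B n] contains [x] and meets [A m n] at [y], and [A m n] belongs to [V n]. *)
  have [_ [m _ <-] [_ [[B UB ->] [y [Wy By]] Bx]]] :
    (\bigcup_(S in range (fun n => star (W n) (selections U))) S) x.
    by rewrite covW.
  exists m => n mn; exists (B n); last exact: Bx.
  split; first exact: UB.
  exists y; split; last exact: By.
  exists (A m n); first by exists m.
  by move: Wy; rewrite (AP m).2; exact.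
have finT F : finite_set F -> exists2 S, range T S & F `<=` S.
  by move=> finF; have [n Fn] := eventually_finite_cover finF evT; exists (T n).
split=> //; last by move=> [n _ TnX]; apply: TX; exists n.
split.
  rewrite /is_cover -subTset => x _.
  (* Covering is the singleton case of [finT]. *)
  by have [S TS xS] := finT [set x] (finite_set1 x); exists S => //; exact: xS.
by move=> _ [n _ <-]; apply: star_open; have [[_ opU] _] := coverU n.
Qed.
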